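(* If $m$ and $n$ are both even and $4\le m<n$, then $W(C_{m,n})>W(C_{n,m})$.
   Context: For a digraph $D$, $d_D(u,v)$ is the length of a shortest directed path from $u$ to $v$, and $d_D(u,v)=0$ if there is no such path. The Wiener index is $W(D)=\sum_{(u,v)\in V(D)\times V(D)} d_D(u,v)$, the sum over all ordered pairs. The grid $G_{p,q}=P_p\Box P_q$ has vertices $(i,j)$, $1\le i\le p$ (row, row $1$ being the top row), $1\le j\le q$ (column), with $(i,j)$ adjacent to $(i\pm1,j)$ and $(i,j\pm1)$. For $p\ge 3$ and even $q\ge 4$, the comb orientation $C_{p,q}$ of $G_{p,q}$ is defined as follows. First orient the edges of the Hamiltonian cycle $(1,1),(1,2),\dots,(1,q),(2,q),\dots,(p,q),(p,q-1),(p-1,q-1),\dots,(2,q-1),(2,q-2),(3,q-2),\dots,(p,q-2),(p,q-3),\dots,(2,2),(3,2),\dots,(p,2),(p,1),(p-1,1),\dots,(2,1),(1,1)$ along the cycle (row $1$ rightward; column $q$ downward; arcs $(p,j)\to(p,j-1)$ for even $j$; odd columns $3\le j\le q-1$ upward from row $p$ to row $2$ followed by $(2,j)\to(2,j-1)$; even columns $2\le j\le q-2$ downward from row $2$ to row $p$; column $1$ upward from $(p,1)$ to $(1,1)$). All remaining edges: every remaining horizontal edge $\{(i,j),(i,j+1)\}$ with $2\le i\le p$ is oriented $(i,j)\to(i,j+1)$, and every remaining vertical edge $\{(1,j),(2,j)\}$, $2\le j\le q-1$, is oriented $(2,j)\to(1,j)$. In the claim, $C_{m,n}$ uses $(p,q)=(m,n)$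 and $C_{n,m}$ uses $(p,q)=(n,m)$. *)

(* Defs.v *)
From mathcomp Require Import all_boot.

Set Implicit Arguments.
Unset Strict Implicit.
Unset Printing Implicit Defensive.

Section Digraph.

Variables (T : finType) (e : rel T).

Definition dipath (u v : T) (k : nat) : bool :=
  [exists p : k.-tuple T, [&& path e u p, uniq (u :: p) & last u p == v]].

Lemma connect_dipath (u v : T) : connect e u v -> exists k, dipath u v k.
Proof.
case/connectP=> p e_p ->; case/shortenP: e_p => p' e_p' U_p' _.
by exists (size p'); apply/existsP; exists (in_tuple p'); rewrite e_p' U_p' eqxx.
Qed.

Definition dist (u v : T) : nat :=
  match boolP (connect e u v) with
  | AltTrue uv => ex_minn (connect_dipath uv)
  | AltFalse _ => 0
  end.

Definition wiener : nat := \sum_(uv : T * T) dist uv.1 uv.2.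

End Digraph.

(* A vertex of the grid is written (row, column), with 1-based coordinates;
   row 1 is the top row.  Membership in [1, p] x [1, q] is left to grid_coord.
   The cycle runs along row 1, down column q, then through columns q - 1, ..., 2
   inside rows 2, ..., p (odd columns upward, even ones downward), and finally
   back up column 1. *)
Definition cycle_arc (p q : nat) (u v : nat * nat) : bool :=
  let: (i, j) := u in let: (i', j') := v in
  [|| [&& i == 1, i' == 1 & j' == j.+1],
      [&& j == q, j' == q & i' == i.+1],
      [&& i == p, i' == p, j == j'.+1 & ~~ odd j],
      [&& j' == j, odd j, 3 <= j <= q - 1, i == i'.+1 & 2 <= i'],
      [&& i == 2, i' == 2, j == j'.+1, odd j & 3 <= j <= q - 1],
      [&& j' == j, ~~ odd j, 2 <= j <= q - 2, i' == i.+1 & 2 <= i]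
    | [&& j == 1, j' == 1 & i == i'.+1]].

Definition remaining_arc (p q : nat) (u v : nat * nat) : bool :=
  let: (i, j) := u in let: (i', j') := v in
  [&& ~~ cycle_arc p q u v, ~~ cycle_arc p q v u &
      [&& i' == i, 2 <= i <= p & j' == j.+1]
   || [&& i == 2, i' == 1, j' == j & 2 <= j <= q - 1]].

Definition grid_coord (p q : nat) (x : 'I_p * 'I_q) : nat * nat :=
  (x.1.+1, x.2.+1).

(* The intended range is 3 <= p and 4 <= q with q even. *)
Definition comb (p q : nat) : rel ('I_p * 'I_q) :=
  fun x y => let u := grid_coord x in let v := grid_coord y in
    cycle_arc p q u v || remaining_arc p q u v.

(* Main.v *)
(** A function [f] vanishing on the diagonal, growing by at most one along every
arc and decreasing along some arc out of [u] whenever [u != v] is the distance;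
a closed formula for the distances of the comb is verified with this criterion.
The only arcs from column [j] to column [j - 1] are one in row [p] ([j] even)
and one in row 2 ([j] odd), so a path going left by [d] columns sweeps [d - 1]
full columns and its length is forced; the top row only leads right to
[(1, q)], then down to [(2, q)]; every other distance is a Manhattan distance
up to a small correction.

Summing the formula over the rows of a pair of columns, and then over the pairs
of columns, gives the Wiener index of [C_{2h,2k}] as an explicit polynomial [W]
in [h] and [k].  The leading terms of [W(h,k)] and [W(k,h)] agree, so the exact
value is needed; with [h = e + 2] and [k = e + 3 + d] the difference
[3 (W(h,k) - W(k,h))] is [d + 1] times a polynomial in [d] and [e] with positive
coefficients. *)
Require Import Defs.
From mathcomp Require Import all_boot all_order all_algebra.
From mathcomp Require Import zify ring.

Set Implicit Arguments.
Unset Strict Implicit.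
Unset Printing Implicit Defensive.

(** * Distances from a potential function *)

Section DistPotential.

Variables (T : finType) (e : rel T) (f : T -> T -> nat).
Hypothesis f_refl : forall v, f v v = 0.
Hypothesis f_arc : forall u w v, e u w -> f u v <= (f w v).+1.
Hypothesis f_step : forall u v, u != v -> exists2 w, e u w & f w v < f u v.

Lemma potential_le_path u p : path e u p -> f u (last u p) <= size p.
Proof.
elim: p u => [|w p IHp] u /=; first by rewrite f_refl.
by case/andP=> e_uw /IHp; rewrite -ltnS; apply: leq_trans (f_arc _ e_uw).
Qed.

(** Greedy descent: every arc given by [f_step] lowers [f] by at least one, so [v] is reached within
    [f u v] arcs. *)
Lemma potential_path u v :
  exists p, [/\ path e u p, last u p = v & size p <= f u v].
Proof.
have [n] := ubnP (f u v); elim: n u => // n IHn u lt_n.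
have [-> | /f_step[w e_uw lt_f]] := eqVneq u v; first by exists [::].
have [p [e_p last_p size_p]] := IHn w (leq_trans lt_f lt_n).
by exists (w :: p); rewrite /= e_uw; split=> //; apply: leq_ltn_trans lt_f.
Qed.

Lemma dist_potential u v : dist e u v = f u v.
Proof.
have [p [e_p last_p size_p]] := potential_path u v.
rewrite /dist; case: {-}_ / boolP => [uv | /negP[]]; last first.
  by apply/connectP; exists p.
case: ex_minnP => k /existsP[t /and3P[e_t _ /eqP last_t]] min_k.
apply/eqP; rewrite eqn_leq; apply/andP; split.
  (* [dipath] asks for a simple path, so the descent path is shortened; its length can only drop. *)
  case/shortenP: e_p last_p size_p => p' e_p' U_p' sub_p' last_p' size_p.
  have U_p: uniq p' by case/andP: U_p'.
  apply: leq_trans (min_k (size p') _) (leq_trans (uniq_leq_size U_p sub_p') size_p).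
  by apply/existsP; exists (in_tuple p'); rewrite e_p' U_p' last_p' eqxx.
by have := potential_le_path e_t; rewrite last_t size_tuple.
Qed.

End DistPotential.

(** * Distances in the comb *)

(** The arcs sorted by direction (right, left in row [p], left in row 2, down, up), free of the
    negated clauses of [remaining_arc]. *)
Definition grid_arc (p q i j i' j' : nat) :=
  [|| [&& i' == i, j' == j.+1 &
        [|| i == 1, 2 < i < p, (i == 2) && odd j | (i == p) && ~~ odd j]],
      [&& i == p, i' == p, j == j'.+1 & ~~ odd j],
      [&& i == 2, i' == 2, j == j'.+1 & odd j],
      [&& j' == j, i' == i.+1, ~~ odd j & (1 < i) || (j == q)]
    | [&& j' == j, i == i'.+1 & odd j || (i == 2) && (j < q)]].

(* Lengths of the vertical moves needed to leave column [j] and to reach row [a]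
   after entering column [b], when travelling left. *)
Definition exit_dist (p j i : nat) := if odd j then i - 2 else p - i.
Definition entry_dist (p b a : nat) :=
  if odd b then p - a else if a == 1 then 1 else a - 2.

(* A vertical move against the orientation of a column makes a detour through
   the row-2 arc or through the row-[p] arc between two adjacent columns. *)
Definition turn_dist (p i a : nat) := minn (i + a - 2) (2 * p + 2 - i - a).

(** Columns 1 and [q] have a neighbour on one side only, which leaves just the detour through row
    [p]. In the other even columns, row 1 is reached by the row-2 detour and one arc up; from row 2
    that arc suffices. *)
Definition column_dist (p q j i a : nat) :=
  if odd j then
    if a <= i then i - a
    else if j == 1 then 2 * p + 2 - i - a else turn_dist p i a
  else if i <= a then a - i
  else if j == q then 2 * p + 2 - i - a
  else if a == 1 then if i == 2 then 1 else i.+1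
  else turn_dist p i a.

(* Rows 2 and [p] cannot be followed to the right for more than one step, which
   costs an extra 2 when both ends lie in the same such row. *)
Definition right_dist (p i j a b : nat) :=
  (i - a) + (a - i) + (b - j)
  + (if (i == 2) && (a == 2) && ~~ (odd j && (b == j.+1))
        || (i == p) && (a == p) && ~~ (~~ odd j && (b == j.+1)) then 2 else 0).

Definition low_dist (p q i j a b : nat) :=
  if b < j then
    exit_dist p j i + (j - b) + (j - b).-1 * (p - 2) + entry_dist p b a
  else if j < b then right_dist p i j a b
  else column_dist p q j i a.

Definition comb_dist (p q i j a b : nat) :=
  if i == 1 then
    if (a == 1) && (j <= b) then b - j
    else (q - j).+1 + low_dist p q 2 q a b
  else low_dist p q i j a b.

Lemma comb_dist_low p q i j a b :
  1 < i -> comb_dist p q i j a b = low_dist p q i j a b.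
Proof. by rewrite /comb_dist; case: eqP => // ->. Qed.

(** One more column adds one sweep of [p - 2] arcs between rows 2 and [p]. The remaining product is
    then common to both sides and can be abstracted before [lia]. *)
Lemma snake_left p j b : b < j ->
  (j.+1 - b).-1 * (p - 2) = p - 2 + (j - b).-1 * (p - 2).
Proof. by move=> ?; rewrite -mulSn; congr (_ * _); lia. Qed.

Lemma snake_start p j : (j.+1 - j).-1 * (p - 2) = 0.
Proof. by rewrite subSnn. Qed.

Ltac unfold_dist := rewrite /comb_dist /low_dist /right_dist /column_dist
  /turn_dist /exit_dist /entry_dist.
Ltac unfold_low := rewrite !comb_dist_low; try lia; unfold_dist.
(** Conditions settled by the context are discharged first, so that only open ones are split. *)
Ltac split_ifs := repeat match goal with |- context [if ?b then _ else _] =>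
  first [ have -> : b = true by lia
        | have -> : b = false by lia
        | let E := fresh "E" in destruct b eqn:E ]
  end.
Ltac dist_lia := split_ifs;
  repeat match goal with |- context [?x * (?y - 2)] =>
    generalize (x * (y - 2)); intro end; lia.

Section CombDistance.

Variables p q : nat.
Hypotheses (p_gt3 : 3 < p) (q_gt3 : 3 < q) (q_even : ~~ odd q).

Lemma grid_arcE i j i' j' :
  0 < i <= p -> 0 < j <= q -> 0 < i' <= p -> 0 < j' <= q ->
  cycle_arc p q (i, j) (i', j') || remaining_arc p q (i, j) (i', j')
    = grid_arc p q i j i' j'.
Proof.
rewrite /remaining_arc /cycle_arc /grid_arc => i_bd j_bd i'_bd j'_bd.
(* As [q] is even, an odd column is never the last one; this decides which boundary clauses can
   apply. *)
have j_par : if odd j then (j < q) && ((j == 1) || (2 < j)) else 1 < j.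
  by case: ifP; lia.
have j'_par : if odd j' then (j' < q) && ((j' == 1) || (2 < j')) else 1 < j'.
  by case: ifP; lia.
have nS n : ((n == n.+1) = false) * ((n.+1 == n) = false) * ((n == n.+2) = false).
  by split; [split |]; lia.
have simp := (eqxx, nS, andbF, andbT, orbF).
have [? | jj'] := eqVneq j' j; first subst j'.
  rewrite ?simp /= ?simp.
  have [? | ii'] := eqVneq i' i.+1; first by subst i'; rewrite ?simp /= ?simp; lia.
  by have [? | i'i] := eqVneq i i'.+1; [subst i |]; rewrite ?simp /= ?simp; lia.
have [? | jj1] := eqVneq j' j.+1; first subst j'.
  rewrite ?simp /= ?simp.
  have [? | ii'] := eqVneq i' i; [subst i' |]; rewrite ?simp /= ?simp; last by lia.
  by move: j_par j'_par => /=; case: (odd j); rewrite /= ?simp; lia.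
have [? | j'j] := eqVneq j j'.+1; first subst j.
  by move: j_par j'_par => /=; case: (odd j'); rewrite ?simp /= ?simp; lia.
by rewrite ?(eq_sym j) ?(negbTE jj') ?(negbTE jj1) ?simp /= ?simp; lia.
Qed.

(** * The arc inequality for the closed formula, direction by direction *)

Lemma comb_dist_refl i j : 0 < i <= p -> 0 < j <= q -> comb_dist p q i j i j = 0.
Proof. by move=> i_bd j_bd; unfold_dist; rewrite ltnn leqnn leqnn andbT; dist_lia. Qed.

Lemma comb_dist_right i j a b :
  0 < i <= p -> 0 < j -> 0 < a <= p -> 0 < b <= q -> j < q ->
  [|| i == 1, 2 < i < p, (i == 2) && odd j | (i == p) && ~~ odd j] ->
  comb_dist p q i j a b <= (comb_dist p q i j.+1 a b).+1.
Proof.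
move=> i_bd j_bd a_bd b_bd jq arc; rewrite /comb_dist.
have [_ | i_neq1] := eqVneq i 1.
  (* Both sides contain the same distance from [(2, q)], whose value does not matter. *)
  by move: (low_dist _ _ _ _ _ _) => d; dist_lia.
unfold_dist; case: (ltngtP b j) => bj.
- have -> : b < j.+1 by lia.
  by rewrite (snake_left _ bj); dist_lia.
- have -> : (b < j.+1) = false by lia.
  by dist_lia.
- by subst b; rewrite ltnSn snake_start; dist_lia.
Qed.

Lemma comb_dist_left i j a b :
  0 < i <= p -> 0 < j < q -> 0 < a <= p -> 0 < b <= q ->
  (i == p) && odd j || (i == 2) && ~~ odd j ->
  comb_dist p q i j.+1 a b <= (comb_dist p q i j a b).+1.
Proof.
move=> i_bd j_bd a_bd b_bd arc; rewrite /comb_dist.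
have [i1 | i_neq1] := eqVneq i 1; first by lia.
unfold_dist; case: (ltngtP b j) => bj.
- have -> : b < j.+1 by lia.
  by rewrite (snake_left _ bj); dist_lia.
- have -> : (b < j.+1) = false by lia.
  by dist_lia.
- by subst b; rewrite ltnSn snake_start subSnn; dist_lia.
Qed.

Lemma comb_dist_down i j a b :
  0 < i < p -> 0 < j <= q -> 0 < a <= p -> 0 < b <= q ->
  ~~ odd j && (1 < i) || (j == q) ->
  comb_dist p q i j a b <= (comb_dist p q i.+1 j a b).+1.
Proof.
move=> i_bd j_bd a_bd b_bd arc; rewrite /comb_dist.
have [i1 | i_neq1] := eqVneq i 1.
  subst i; have -> : j = q by lia.
  by move: (low_dist _ _ _ _ _ _) => d; dist_lia.
have -> : (i.+1 == 1) = false by lia.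
by unfold_dist; dist_lia.
Qed.

Lemma comb_dist_up i j a b :
  0 < i < p -> 0 < j <= q -> 0 < a <= p -> 0 < b <= q ->
  odd j || (i == 1) && (j < q) ->
  comb_dist p q i.+1 j a b <= (comb_dist p q i j a b).+1.
Proof.
move=> i_bd j_bd a_bd b_bd arc; rewrite /comb_dist.
have -> : (i.+1 == 1) = false by lia.
have [-> | i_neq1] := eqVneq i 1; unfold_dist; last by dist_lia.
rewrite (negbTE q_even).
(* From row 1 the walk restarts at [(2, q)]; its sweeps towards column [b] are split at column [j],
   to be compared with those starting from [(2, j)]. *)
have snake : b < j ->
    (q - b).-1 * (p - 2) = (q - j) * (p - 2) + (j - b).-1 * (p - 2).
  by move=> ?; rewrite -mulnDl; congr (_ * _); lia.
by case: (ltngtP b j) => bj; [rewrite (snake bj) | |]; dist_lia.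
Qed.

Lemma comb_dist_arc i j i' j' a b : 0 < i <= p -> 0 < j <= q ->
  0 < i' <= p -> 0 < j' <= q -> 0 < a <= p -> 0 < b <= q ->
  grid_arc p q i j i' j' ->
  comb_dist p q i j a b <= (comb_dist p q i' j' a b).+1.
Proof.
move=> i_bd j_bd i'_bd j'_bd a_bd b_bd.
case/or4P => [/and3P[/eqP-> /eqP ej arc]|/and4P[/eqP ei /eqP-> /eqP ej arc]||/orP[]].
- by subst j'; apply: comb_dist_right; lia.
- by subst i j; apply: comb_dist_left; lia.
- by case/and4P=> /eqP ei /eqP-> /eqP ej arc; subst i j; apply: comb_dist_left; lia.
- by case/and3P=> /eqP-> /eqP ei arc; subst i'; apply: comb_dist_down; lia.
- by case/and3P=> /eqP-> /eqP ei arc; subst i; apply: comb_dist_up; lia.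
Qed.

(** * Existence of an arc that decreases the closed formula *)

Definition closer (i j a b : nat) := exists i' j',
  [/\ 0 < i' <= p, 0 < j' <= q, grid_arc p q i j i' j' &
      comb_dist p q i' j' a b < comb_dist p q i j a b].

Lemma closer_go_right i j a b : 0 < i <= p -> 0 < j < q ->
  [|| i == 1, 2 < i < p, (i == 2) && odd j | (i == p) && ~~ odd j] ->
  comb_dist p q i j.+1 a b < comb_dist p q i j a b -> closer i j a b.
Proof.
move=> i_bd /andP[_ jq] arc lt; exists i, j.+1; split=> //.
by rewrite /grid_arc !eqxx arc.
Qed.

Lemma closer_go_left i j a b : 0 < i <= p -> 0 < j < q ->
  (i == p) && odd j || (i == 2) && ~~ odd j ->
  comb_dist p q i j a b < comb_dist p q i j.+1 a b -> closer i j.+1 a b.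
Proof.
move=> i_bd /andP[j_gt0 jq] arc lt; exists i, j; split=> //.
  by rewrite j_gt0 ltnW.
rewrite /grid_arc /= negbK.
by case/orP: arc => /andP[-> ->]; rewrite !eqxx /= ?orbT.
Qed.

Lemma closer_go_down i j a b : 0 < i < p -> 0 < j <= q ->
  ~~ odd j && ((1 < i) || (j == q)) ->
  comb_dist p q i.+1 j a b < comb_dist p q i j a b -> closer i j a b.
Proof.
move=> /andP[_ ip] j_bd arc lt; exists i.+1, j; split=> //.
by rewrite /grid_arc !eqxx arc !orbT.
Qed.

Lemma closer_go_up i j a b : 0 < i < p -> 0 < j <= q ->
  odd j || (i == 1) && (j < q) ->
  comb_dist p q i j a b < comb_dist p q i.+1 j a b -> closer i.+1 j a b.
Proof.
move=> /andP[i_gt0 ip] j_bd arc lt; exists i, j; split=> //.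
  by rewrite i_gt0 ltnW.
by rewrite /grid_arc !eqxx eqSS arc !orbT.
Qed.

Lemma closer_row1 j a b : 0 < j <= q -> 0 < a <= p -> 0 < b <= q ->
  (1, j) != (a, b) -> closer 1 j a b.
Proof.
move=> j_bd a_bd b_bd; rewrite xpair_eqE => neq.
have [jq | jq] := ltnP j q.
  apply: closer_go_right; [lia | lia | lia |]; rewrite /comb_dist eqxx.
  by move: (low_dist _ _ _ _ _ _) => d; dist_lia.
have ? : j = q by lia.
subst j; apply: closer_go_down; [lia | lia | lia |]; rewrite /comb_dist eqxx /=.
by move: (low_dist _ _ _ _ _ _) => d; dist_lia.
Qed.

Ltac go_right := apply: closer_go_right; [lia | lia | lia |]; unfold_low; dist_lia.
Ltac go_down := apply: closer_go_down; [lia | lia | lia |]; unfold_low; dist_lia.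
Ltac go_up := apply: closer_go_up; [lia | lia | lia |]; unfold_low; dist_lia.

(** The next arc follows the snake: along the column to its exit row, then left. *)
Lemma closer_left i j a b : 1 < i <= p -> 0 < j <= q -> 0 < a <= p -> 0 < b < j ->
  closer i j a b.
Proof.
case: j => // j i_bd j_bd a_bd b_bd.
have go_left : (i == p) && odd j || (i == 2) && ~~ odd j -> closer i j.+1 a b.
  move=> arc; apply: closer_go_left; [lia | lia | lia |]; unfold_low.
  have [-> | bj] := eqVneq b j; first by rewrite snake_start subSnn; dist_lia.
  by rewrite snake_left; [dist_lia | lia].
have [oj | oj] := boolP (odd j).
  by have [ip | ip] := ltnP i p; [go_down | apply: go_left; lia].
have [ip | ip] := ltnP 2 i; last by apply: go_left; lia.
by case: i i_bd ip {go_left} => // i i_bd ip; go_up.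
Qed.

Lemma closer_right i j a b : 1 < i <= p -> 0 < j < b -> 0 < a <= p -> b <= q ->
  closer i j a b.
Proof.
move=> i_bd j_bd a_bd b_bd.
have [ai | ai | ai] := ltngtP a i; have [oj | oj] := boolP (odd j).
(* Entering row 2 too early would incur the extra 2 of [right_dist], so here the move to the right
   comes first. *)
- have [/and3P[/eqP i3 /eqP a2 bj] | c] := boolP [&& i == 3, a == 2 & b != j.+1].
    by subst i a; go_right.
  case: i i_bd ai c => // i i_bd ai c.
  have [i1 | i_gt1] := eqVneq i 1; last by go_up.
  subst i; apply: closer_go_up; [lia | lia | lia |].
  have -> : a = 1 by lia.
  by unfold_dist; dist_lia.
- have [i2 | i_neq2] := eqVneq i 2; last by go_right.
  subst i; apply: closer_go_up; [lia | lia | lia |].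
  have -> : a = 1 by lia.
  by unfold_dist; dist_lia.
- by go_right.
(* The mirror exception, at row [p]. *)
- have [c | c] := boolP [&& i == p.-1, a == p & b != j.+1]; last by go_down.
  by go_right.
- subst a; have [ip | ip] := eqVneq i p; last by go_right.
  by case: i i_bd a_bd ip => // i i_bd a_bd ip; go_up.
- subst a; have [? | i_neq2] := eqVneq i 2; last by go_right.
  by subst i; go_down.
Qed.

Lemma closer_column i j a : 1 < i <= p -> 0 < j <= q -> 0 < a <= p -> i != a ->
  closer i j a j.
Proof.
move=> i_bd j_bd a_bd ia.
have [oj | oj] := boolP (odd j).
  have [ai | ai] := ltnP a i.
    case: i i_bd ai {ia} => // i i_bd ai.
    have [? | i_neq1] := eqVneq i 1; last by go_up.
    subst i; apply: closer_go_up; [lia | lia | lia |].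
    have -> : a = 1 by lia.
    by unfold_dist; dist_lia.
  (* The two lengths are those of the row-[p] and row-2 detours. Against an odd column, the former
     starts to the right, the latter goes up to row 2 and then left. *)
  have [far | near] := boolP ((j == 1) || (2 * p + 2 - i - a < i + a - 2)).
    apply: closer_go_right; [lia | lia | lia |].
    by unfold_low; rewrite snake_start; dist_lia.
  case: i i_bd ai ia near => // i i_bd ai ia near.
  have [? | i_neq1] := eqVneq i 1; last by go_up.
  subst i; case: j j_bd oj near => // j j_bd oj near.
  by apply: closer_go_left; [lia | lia | lia |]; unfold_low; dist_lia.
have [ai | ai] := ltnP i a; first by go_down.
have [/and3P[jq /eqP a1 /eqP i2] | ntop] := boolP [&& j < q, a == 1 & i == 2].
  by subst i a; apply: closer_go_up; [lia | lia | lia |]; unfold_dist; dist_lia.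
(* Against an even column the roles are exchanged: the row-2 detour starts to the right, the row-[p]
   one goes down and then left. *)
have [near | far] :=
    boolP ((j < q) && ((a == 1) || (i + a - 2 <= 2 * p + 2 - i - a))).
  apply: closer_go_right; [lia | lia | lia |].
  by unfold_low; rewrite snake_start; dist_lia.
have [ip | ip] := ltnP i p; first by go_down.
have ? : i = p by lia.
subst i; case: j j_bd oj {ntop} far => // j j_bd oj far.
by apply: closer_go_left; [lia | lia | lia |]; unfold_low; dist_lia.
Qed.

Lemma comb_dist_closer i j a b : 0 < i <= p -> 0 < j <= q ->
  0 < a <= p -> 0 < b <= q -> (i, j) != (a, b) -> closer i j a b.
Proof.
move=> i_bd j_bd a_bd b_bd neq.
have [i1 | i_gt1] := eqVneq i 1; first by subst i; apply: closer_row1.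
have {}i_bd : 1 < i <= p by lia.
have [jb | bj | jb] := ltngtP j b.
- by apply: closer_right => //; lia.
- by apply: closer_left => //; lia.
subst b; apply: closer_column => //.
by apply: contraNneq neq => ->.
Qed.

Lemma dist_comb (x y : 'I_p * 'I_q) :
  dist (@comb p q) x y = comb_dist p q x.1.+1 x.2.+1 y.1.+1 y.2.+1.
Proof.
have bd n (i : 'I_n) : 0 < i.+1 <= n by rewrite ltn_ord.
have combE u v : @comb p q u v = grid_arc p q u.1.+1 u.2.+1 v.1.+1 v.2.+1.
  exact: grid_arcE.
rewrite (@dist_potential _ _
  (fun u v : 'I_p * 'I_q => comb_dist p q u.1.+1 u.2.+1 v.1.+1 v.2.+1)) //.
- by move=> v; apply: comb_dist_refl.
- by move=> u w v; rewrite combE; apply: comb_dist_arc.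
move=> u v neq.
have neq' : (u.1.+1, u.2.+1) != (v.1.+1, v.2.+1).
  by case: u v neq => [u1 u2] [v1 v2].
have [i [j [i_bd j_bd arc lt]]] :=
  comb_dist_closer (bd _ u.1) (bd _ u.2) (bd _ v.1) (bd _ v.2) neq'.
case: i j i_bd j_bd arc lt => // i [] // j i_bd j_bd arc lt.
by exists (Ordinal i_bd, Ordinal j_bd); rewrite ?combE.
Qed.

End CombDistance.

(** * The Wiener index of the comb *)

Section CombWiener.

Import Order.TTheory GRing.Theory Num.Theory.
Local Open Scope ring_scope.

(** * Summation identities *)

Lemma sum_square_split (V : nmodType) (F : nat -> nat -> V) n :
  \sum_(i < n) \sum_(j < n) F i j
    = \sum_(i < n) F i i + \sum_(i < n) \sum_(j < i) (F i j + F j i).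
Proof.
elim: n => [|n IHn]; first by rewrite !big_ord0 addr0.
rewrite big_ord_recr /= (eq_bigr (fun i : 'I_n => \sum_(j < n) F i j + F i n));
  last by move=> i _; rewrite big_ord_recr.
rewrite 3!big_ord_recr /= !big_split /= IHn -!addrA; congr (_ + _).
by rewrite [RHS]addrC -!addrA; congr (_ + _); rewrite addrCA.
Qed.

(** Sources start in row 2 and targets in row 1, so [a = 0] is the top row and [a = x.+1] is the row
    of the source itself. *)
Lemma sum_strip_split (V : nmodType) (G : nat -> nat -> V) n :
  \sum_(x < n) \sum_(a < n.+1) G x a
    = \sum_(x < n) G x 0%N + \sum_(x < n) G x x.+1
      + \sum_(x < n) \sum_(y < x) (G x y.+1 + G y x.+1).
Proof.
rewrite (eq_bigr (fun x : 'I_n => G x 0%N + \sum_(y < n) G x y.+1));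
  last by move=> x _; rewrite big_ord_recl.
by rewrite big_split /= (sum_square_split (fun x y => G x y.+1)) addrA.
Qed.

Lemma sum_const_int n (c : int) : \sum_(i < n) c = c * n%:Z.
Proof. by rewrite sumr_const card_ord -mulr_natr natz. Qed.

Lemma sum_delta n k :
  \sum_(x < n) ((x == k :> nat) : nat)%:Z = ((k < n)%N : nat)%:Z.
Proof.
elim: n => [|n IHn]; first by rewrite big_ord0.
by rewrite big_ord_recr /= IHn; lia.
Qed.

(** Here and below, closed forms over [int] carry a factor that clears denominators. *)
Lemma sum_affine n (c d : int) :
  2 * (\sum_(i < n) (c + d * i%:Z)) = 2 * c * n%:Z + d * n%:Z * (n%:Z - 1).
Proof.
elim: n => [|n IHn]; first by rewrite big_ord0; lia.
by rewrite big_ord_recr mulrDr IHn /=; lia.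
Qed.

Lemma sum_updown n (c : bool) :
  2 * \sum_(x < n) (if c then x%:Z else n%:Z - 1 - x%:Z) = n%:Z * (n%:Z - 1).
Proof.
case: c.
  rewrite (eq_bigr (fun x : 'I_n => 0 + 1 * x%:Z)) ?sum_affine; last by lia.
  by ring.
rewrite (eq_bigr (fun x : 'I_n => n%:Z - 1 + (-1) * x%:Z)) ?sum_affine;
  last by lia.
by ring.
Qed.

Lemma sum_parity k (c d : int) :
  \sum_(j < k.*2) (if odd j then c else d) = k%:Z * (c + d).
Proof.
elim: k => [|k IHk]; first by rewrite big_ord0; lia.
by rewrite doubleS !big_ord_recr /= IHk odd_double /=; lia.
Qed.

Lemma sum_triangle_affine n (c d e : int) :
  6 * (\sum_(i < n) \sum_(j < i) (c + d * i%:Z + e * j%:Z)) =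
  n%:Z * (n%:Z - 1) * (3 * c + d * (2 * n%:Z - 1) + e * (n%:Z - 2)).
Proof.
elim: n => [|n IHn]; first by rewrite big_ord0; lia.
rewrite big_ord_recr mulrDr IHn /=.
move: (\sum_(i < n) _) (sum_affine n (c + d * n%:Z) e) => s Es.
have -> : 6 * s = 3 * (2 * s) by ring.
by rewrite Es (_ : n.+1%:Z = n%:Z + 1); [ring | lia].
Qed.

Lemma sum_triangle_parity k (c d : int) :
  \sum_(i < k.*2) \sum_(j < i) (if odd j then c else d)
    = d * k%:Z ^+ 2 + c * k%:Z * (k%:Z - 1).
Proof.
elim: k => [|k IHk]; first by rewrite big_ord0; lia.
by rewrite doubleS !big_ord_recr /= IHk !sum_parity odd_double /=; lia.
Qed.

(** Counts the pairs of adjacent columns, where [right_dist] has its exception. *)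
Lemma sum_triangle_succ n :
  \sum_(i < n.+1) \sum_(j < i) ((i == j.+1 :> nat) : nat)%:Z = n%:Z.
Proof.
elim: n => [|n IHn]; first by rewrite big_ord_recr !big_ord0.
rewrite big_ord_recr IHn /= big_ord_recr eqxx big1 /= => [|i _]; first by lia.
by have := ltn_ord i; lia.
Qed.

(** The summand is [turn_dist n.+1 x.+2 y.+2]. *)
Definition turn_sum n : int :=
  \sum_(x < n) \sum_(y < x) (minn (x + y + 2) (2 * n - x - y))%:Z.

(** Moves along the orientation of a column, in the shape expected by [sum_triangle_affine]. *)
Definition diff_sum n : int :=
  \sum_(x < n) \sum_(y < x) (0 + 1 * x%:Z + (-1) * y%:Z).

(** The forced row-[p] detours in columns 1 and [q]. *)
Definition far_sum n : int :=
  \sum_(x < n) \sum_(y < x) (2 * n%:Z + (-1) * x%:Z + (-1) * y%:Z).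

(** The sum of all row differences between a source below row 1 and any target. *)
Definition abs_sum n : int := \sum_(x < n) (1 + 1 * x%:Z) + 2 * diff_sum n.

(* Removing [x = 0], [y = 0] and [x = n.+1] from the triangle of size [n.+2]
   leaves the one of size [n] with every minimum raised by 2. *)
Lemma turn_sumE k :
  3 * turn_sum k.*2.+1 = k%:Z * (k%:Z + 1) * (8 * k%:Z + 7).
Proof.
rewrite /turn_sum; elim: k => [|k]; first by rewrite big_ord_recr /= !big_ord0.
set n := k.*2.+1; rewrite doubleS -/n => IHk.
rewrite big_ord_recr big_ord_recl big_ord0 /=.
rewrite (eq_bigr (fun x : 'I_n => (3 + 3 * x%:Z) +
   \sum_(y < x) (minn (x + y + 2) (2 * n - x - y))%:Z)); last first.
  move=> x _; have x_lt := ltn_ord x; rewrite big_ord_recl /= /bump /=.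
  rewrite (eq_bigr (fun y : 'I_x => 2 + (minn (x + y + 2) (2 * n - x - y))%:Z)).
    rewrite big_split /= sum_const_int addrA; congr (_ + _).
    by clear IHk; lia.
  by move=> y _; have := ltn_ord y; rewrite /bump /=; lia.
rewrite (eq_bigr (fun y : 'I_n.+1 => (n%:Z + 3) + (-1) * y%:Z)); last first.
  by move=> y _; have := ltn_ord y; lia.
rewrite big_split /=.
move: (\sum_(i < n) \sum_(j < i) _) IHk (sum_affine n 3 3)
  (sum_affine n.+1 (n%:Z + 3) (-1)) => S.
move: (\sum_(i < n) _) (\sum_(i < n.+1) _) => A B.
have -> : n.+1%:Z = 2 * k%:Z + 2 by lia.
have -> : n%:Z = 2 * k%:Z + 1 by lia.
have -> : k.+1%:Z = k%:Z + 1 by lia.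
lia.
Qed.

Lemma diff_sumE n : 6 * diff_sum n = n%:Z * (n%:Z - 1) * (n%:Z + 1).
Proof. by rewrite /diff_sum sum_triangle_affine; ring. Qed.

Lemma far_sumE n : 2 * far_sum n = n%:Z * (n%:Z - 1) * (n%:Z + 1).
Proof.
apply: (@mulfI _ 3) => //; rewrite mulrA -[_ * 2]/(6%:Z) /far_sum.
by rewrite sum_triangle_affine; ring.
Qed.

Lemma abs_sumE n : 6 * abs_sum n = n%:Z * (n%:Z + 1) * (2 * n%:Z + 1).
Proof.
rewrite /abs_sum; have := sum_affine n 1 1; have := diff_sumE n.
move: (\sum_(x < n) _) (diff_sum n) => a b Eb Ea.
transitivity (3 * (2 * a) + 2 * (6 * b)); first by ring.
by rewrite Ea Eb; ring.
Qed.

(** With 0-based [b], [odd b] means that column [b.+1] is even, hence entered at row 2, one arc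
    below row 1. *)
Definition entry_top n b : int := if odd b then 1 else n%:Z.

Lemma entry_distE n b a : (0 < n)%N -> (a < n)%N ->
  (entry_dist n.+1 b.+1 a.+2)%:Z = if odd b then a%:Z else n%:Z - 1 - a%:Z.
Proof. by rewrite /entry_dist /=; case: (odd b) => /=; lia. Qed.

Lemma entry_dist_top n b :
  (0 < n)%N -> (entry_dist n.+1 b.+1 1)%:Z = entry_top n b.
Proof. by rewrite /entry_dist /entry_top /=; case: (odd b) => /=; lia. Qed.

Lemma snakeE n d : (0 < n)%N ->
  (d.+1 + d * (n.+1 - 2))%N%:Z = d.+1%:Z * n%:Z - (n%:Z - 1).
Proof. by case: n => // n _; rewrite !subSS subn0; lia. Qed.

(* Row and column indices are shifted to start at 0, and the grid has [n + 1]
   rows: an index [x < n] stands for row [x + 2], and [a <= n] for row [a + 1]. *)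
Variables n q : nat.
Hypotheses (n_gt2 : (2 < n)%N) (q_gt3 : (3 < q)%N) (q_even : ~~ odd q).

Local Notation N := n%:Z.
Local Notation Q := q%:Z.

(** * Sums over the rows of a pair of columns *)

Definition low_sum j b : int :=
  \sum_(x < n) \sum_(a < n.+1) (low_dist n.+1 q x.+2 j.+1 a.+1 b.+1)%:Z.

Definition top_sum j b : int :=
  \sum_(a < n.+1) (comb_dist n.+1 q 1 j.+1 a.+1 b.+1)%:Z.

Lemma wiener_split : (wiener (@comb n.+1 q))%:Z =
  \sum_(j < q) \sum_(b < q) (top_sum j b + low_sum j b).
Proof.
have PoszS := big_morph Posz PoszD (erefl _).
rewrite /wiener.
rewrite (eq_bigr _ (fun uv _ => @dist_comb n.+1 q n_gt2 q_gt3 q_even uv.1 uv.2)).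
rewrite -(pair_bigA _ (fun u v : 'I_n.+1 * 'I_q =>
  comb_dist n.+1 q u.1.+1 u.2.+1 v.1.+1 v.2.+1)) /=.
rewrite -(pair_bigA _ (fun (i : 'I_n.+1) (j : 'I_q) =>
  \sum_(v : 'I_n.+1 * 'I_q) comb_dist n.+1 q i.+1 j.+1 v.1.+1 v.2.+1)%N) /=.
rewrite exchange_big PoszS; apply: eq_bigr => j _.
have rowE i :
    (\sum_(v : 'I_n.+1 * 'I_q) comb_dist n.+1 q i j.+1 v.1.+1 v.2.+1)%N
    = (\sum_(b < q) \sum_(a < n.+1) comb_dist n.+1 q i j.+1 a.+1 b.+1)%N.
  by rewrite -(pair_bigA _ (fun (a : 'I_n.+1) (b : 'I_q) =>
    comb_dist n.+1 q i j.+1 a.+1 b.+1)) exchange_big.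
rewrite (eq_bigr _ (fun (i : 'I_n.+1) _ => rowE i.+1)) exchange_big PoszS.
apply: eq_bigr => b _; rewrite big_ord_recl PoszD PoszS.
congr (_ + _); rewrite PoszS; apply: eq_bigr => x _.
by rewrite PoszS; apply: eq_bigr => a _; rewrite lift0 comb_dist_low.
Qed.

Lemma low_dist_left i j a b : (b < j)%N ->
  (low_dist n.+1 q i j a b)%:Z = (exit_dist n.+1 j i)%:Z
    + ((j%:Z - b%:Z) * N - (N - 1)) + (entry_dist n.+1 b a)%:Z.
Proof.
move=> bj; rewrite /low_dist bj.
have [d ->] : exists d, j = (b + d.+1)%N by exists (j - b).-1; lia.
have -> : (b + d.+1 - b = d.+1)%N by lia.
have n_gt0 : (0 < n)%N by lia.
have := @snakeE n d n_gt0; rewrite /=.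
move: (d * _)%N (exit_dist _ _ _) (entry_dist _ _ _) => s r f; lia.
Qed.

(** The distance is separable: the exit depends on the source row only, the entry on the target row
    only, and the sweeps on neither. *)
Lemma low_sum_left j b : (b < j)%N ->
  2 * low_sum j b = N * (N + 1) * (N - 1)
    + 2 * N * (N + 1) * ((j%:Z - b%:Z) * N - (N - 1))
    + N * (N * (N - 1) + 2 * entry_top n b).
Proof.
move=> bj; rewrite /low_sum.
pose r x := if ~~ odd j then x%:Z else N - 1 - x%:Z.
pose c := (j%:Z - b%:Z) * N - (N - 1).
pose s := \sum_(a < n) if odd b then a%:Z else N - 1 - a%:Z.
rewrite (eq_bigr (fun x : 'I_n =>
    (N + 1) * r x + ((N + 1) * c + (entry_top n b + s)))).
  rewrite big_split /= sum_const_int -mulr_sumr.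
  have := sum_updown n (odd b); have := sum_updown n (~~ odd j).
  rewrite -/s -/r; move: s (\sum_(_ < _) _) => s t Et Es.
  transitivity ((N + 1) * (2 * t) + N * (2 * s)
    + N * 2 * ((N + 1) * c + entry_top n b)); first by ring.
  by rewrite Et Es /c; ring.
move=> x _; have x_lt := ltn_ord x.
rewrite (eq_bigr (fun a : 'I_n.+1 =>
    (r x + c) + (entry_dist n.+1 b.+1 a.+1)%:Z)); last first.
  move=> a _; rewrite low_dist_left //; congr (_ + _ + _); last by rewrite /c; lia.
  by rewrite /r /exit_dist /=; case: (odd j) => /=; lia.
rewrite big_split /= sum_const_int big_ord_recl /= entry_dist_top; last by lia.
rewrite (eq_bigr (fun a : 'I_n => if odd b then a%:Z else N - 1 - a%:Z));
  last by move=> a _; rewrite /bump /= add1n entry_distE //; lia.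
by rewrite -/s (_ : n.+1%:Z = N + 1); [ring | lia].
Qed.

(** The 4 is the extra 2 for row 2 plus the one for row [p]; between adjacent columns exactly one of
    them disappears, depending on parity. *)
Lemma low_sum_right j b : (j < b)%N ->
  low_sum j b = abs_sum n + N * (N + 1) * (b%:Z - j%:Z) + 4
    - 2 * ((b == j.+1 :> nat) : nat)%:Z.
Proof.
move=> jb; rewrite /low_sum.
have lowE x a :
    low_dist n.+1 q x.+2 j.+1 a.+1 b.+1 = right_dist n.+1 x.+2 j.+1 a.+1 b.+1.
  by rewrite /low_dist !ltnS jb ltnNge (ltnW jb).
(* [c1] and [c2] tell whether the extra 2 is due in row 2 ([x = 0]) and in row [p] ([x = n.-1]). *)
pose c1 := ((~~ (odd j.+1 && (b == j.+1))) : nat)%:Z.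
pose c2 := ((~~ (~~ odd j.+1 && (b == j.+1))) : nat)%:Z.
pose d x y := 0 + 1 * x%:Z + (-1) * y%:Z.
pose g x := 1 + 1 * x%:Z.
rewrite (sum_strip_split
  (fun x a => (low_dist n.+1 q x.+2 j.+1 a.+1 b.+1)%:Z)).
rewrite (eq_bigr (fun x : 'I_n => (b%:Z - j%:Z) + g x)); last first.
  by move=> x _; have x_lt := ltn_ord x; rewrite lowE /right_dist /g; dist_lia.
rewrite [X in _ + X + _](eq_bigr (fun x : 'I_n => (b%:Z - j%:Z)
    + (2 * c1 * ((x == 0 :> nat) : nat)%:Z
       + 2 * c2 * ((x == n.-1 :> nat) : nat)%:Z))); last first.
  move=> x _; have x_lt := ltn_ord x; rewrite lowE /right_dist /c1 /c2 /=.
  by case: (odd j); case: (eqVneq b j.+1) => bj /=; dist_lia.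
rewrite [X in _ + X](eq_bigr (fun x : 'I_n =>
    \sum_(y < x) (2 * (b%:Z - j%:Z)) + 2 * \sum_(y < x) d x y)); last first.
  move=> x _; rewrite mulr_sumr -big_split /=; apply: eq_bigr => y _.
  have x_lt := ltn_ord x; have y_lt := ltn_ord y.
  by rewrite !lowE /right_dist /d; dist_lia.
rewrite [X in X + _ + _]big_split [X in _ + X + _]big_split /=.
rewrite [X in _ + (_ + X) + _]big_split [X in _ + X = _]big_split /=.
rewrite -!mulr_sumr !sum_delta !sum_const_int /abs_sum /diff_sum.
have := sum_triangle_affine n (2 * (b%:Z - j%:Z)) 0 0.
rewrite (eq_bigr (fun x : 'I_n => \sum_(y < x) (2 * (b%:Z - j%:Z)))); last first.
  by move=> x _; apply: eq_bigr => y _; ring.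
have c12 : c1 + c2 = 2 - ((b == j.+1 :> nat) : nat)%:Z.
  by rewrite /c1 /c2; case: (odd _); case: eqP.
rewrite -/d -/g; move: c1 c2 c12 => c1 c2 c12.
move: (\sum_(x < n) g x) (\sum_(x < n) \sum_(y < x) d x y) (\sum_(_ < n) _).
move=> A B C EC.
have [-> ->] : ((0 < n)%N : nat) = 1%N /\ ((n.-1 < n)%N : nat) = 1%N by lia.
apply: (@mulfI _ 6) => //.
transitivity (6 * A + 12 * B + 6 * C + 12 * N * (b%:Z - j%:Z) + 12 * (c1 + c2));
  first by ring.
by rewrite EC c12; ring.
Qed.

(** [h] covers the targets in row 1, [f] the upward pairs and [g] the downward pairs. *)
Lemma low_sum_column j (f g : nat -> nat -> int) (h : nat -> int) :
  (forall x, (x < n)%N -> (low_dist n.+1 q x.+2 j.+1 1 j.+1)%:Z = h x) ->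
  (forall x, (x < n)%N -> (low_dist n.+1 q x.+2 j.+1 x.+2 j.+1)%:Z = 0) ->
  (forall x y, (y < x < n)%N ->
    (low_dist n.+1 q x.+2 j.+1 y.+2 j.+1)%:Z = f x y) ->
  (forall x y, (y < x < n)%N ->
    (low_dist n.+1 q y.+2 j.+1 x.+2 j.+1)%:Z = g x y) ->
  low_sum j j = \sum_(x < n) h x
    + (\sum_(x < n) \sum_(y < x) f x y + \sum_(x < n) \sum_(y < x) g x y).
Proof.
move=> hE dE fE gE; rewrite /low_sum.
rewrite (sum_strip_split
  (fun x a => (low_dist n.+1 q x.+2 j.+1 a.+1 j.+1)%:Z)).
congr (_ + _).
  rewrite [X in _ + X]big1 ?addr0 => [|x _]; last by apply: dE.
  by apply: eq_bigr => x _; apply: hE.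
rewrite -big_split; apply: eq_bigr => x _ /=.
rewrite -big_split; apply: eq_bigr => y _ /=.
by rewrite fE ?gE ?ltn_ord.
Qed.

Lemma low_sum_first :
  low_sum 0 0 = \sum_(x < n) (1 + 1 * x%:Z) + (diff_sum n + far_sum n).
Proof.
apply: (@low_sum_column 0
  (fun x y => 0 + 1 * x%:Z + (-1) * y%:Z)
  (fun x y => 2 * N + (-1) * x%:Z + (-1) * y%:Z)
  (fun x => 1 + 1 * x%:Z)) => [x x_lt|x x_lt|x y xy_lt|x y xy_lt]; unfold_dist.
all: by rewrite !ltnn /=; dist_lia.
Qed.

Lemma low_sum_odd j : ~~ odd j -> (0 < j)%N ->
  low_sum j j = \sum_(x < n) (1 + 1 * x%:Z) + (diff_sum n + turn_sum n).
Proof.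
move=> oj j_gt0.
apply: (@low_sum_column j
  (fun x y => 0 + 1 * x%:Z + (-1) * y%:Z)
  (fun x y => (minn (x + y + 2) (2 * n - x - y))%:Z)
  (fun x => 1 + 1 * x%:Z)) => [x x_lt|x x_lt|x y xy_lt|x y xy_lt]; unfold_dist.
all: by rewrite !ltnn /= ?oj; dist_lia.
Qed.

Lemma low_sum_even j : odd j -> (j < q.-1)%N ->
  low_sum j j = \sum_(x < n) (3 + 1 * x%:Z - 2 * ((x == 0 :> nat) : nat)%:Z)
    + (turn_sum n + diff_sum n).
Proof.
move=> oj jq.
apply: (@low_sum_column j
  (fun x y => (minn (x + y + 2) (2 * n - x - y))%:Z)
  (fun x y => 0 + 1 * x%:Z + (-1) * y%:Z)
  (fun x => 3 + 1 * x%:Z - 2 * ((x == 0 :> nat) : nat)%:Z))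
  => [x x_lt|x x_lt|x y xy_lt|x y xy_lt]; unfold_dist.
all: by rewrite !ltnn /= ?oj; dist_lia.
Qed.

Lemma low_sum_last :
  low_sum q.-1 q.-1 = \sum_(x < n) (2 * N + 1 + (-1) * x%:Z)
    + (far_sum n + diff_sum n).
Proof.
apply: (@low_sum_column q.-1
  (fun x y => 2 * N + (-1) * x%:Z + (-1) * y%:Z)
  (fun x y => 0 + 1 * x%:Z + (-1) * y%:Z)
  (fun x => 2 * N + 1 + (-1) * x%:Z))
  => [x x_lt|x x_lt|x y xy_lt|x y xy_lt]; unfold_dist.
all: by rewrite !ltnn /=; dist_lia.
Qed.

(** A value depending on parity alone, corrected at the first and last columns, is what [sum_parity]
    and [sum_delta] can add up. *)
Lemma low_sum_diag j : (j < q)%N -> 2 * low_sum j j =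
  (if odd j then N ^+ 2 + 5 * N - 4 + 2 * (turn_sum n + diff_sum n)
   else N * (N + 1) + 2 * (diff_sum n + turn_sum n))
  + 2 * (far_sum n - turn_sum n) * ((j == 0 :> nat) : nat)%:Z
  + (2 * N ^+ 2 - 2 * N + 4 + 2 * (far_sum n - turn_sum n))
    * ((j == q.-1 :> nat) : nat)%:Z.
Proof.
move=> jq; have s1 := sum_affine n 1 1.
have [-> | j_neq0] := eqVneq j 0%N.
  rewrite low_sum_first mulrDr s1 /= (_ : (0 == q.-1)%N = false); last by lia.
  by rewrite /=; ring.
have [-> | j_neqq] := eqVneq j q.-1.
  rewrite low_sum_last mulrDr sum_affine.
  by rewrite (_ : odd q.-1) /=; [ring | lia].
have [oj | oj] := boolP (odd j); last first.
  by rewrite low_sum_odd // ?lt0n // mulrDr s1 /=; ring.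
rewrite low_sum_even //; last by lia.
rewrite sumrB -mulr_sumr sum_delta mulrDr mulrBr sum_affine /=.
by rewrite (_ : (0 < n)%N) /=; [ring | lia].
Qed.

Lemma top_sumE j b : (j < q)%N -> (b < q)%N ->
  2 * top_sum j b = 2 * N * (Q - j%:Z) + 2 * N ^+ 2 * (Q - 1 - b%:Z)
    + N * (N - 1) + 2 * (if (j <= b)%N then b%:Z - j%:Z
        else (Q - j%:Z) + (Q - 1 - b%:Z) * N + entry_top n b).
Proof.
move=> jq bq; rewrite /top_sum big_ord_recl /=.
(* Leaving [(2, q)] costs a full sweep, which cancels the [N - 1] of [low_dist_left]. The formula
   persists in column [q], except for the target [(1, q)]. *)
have lowE a : (0 < a)%N || (b < q.-1)%N ->
    (low_dist n.+1 q 2 q a.+1 b.+1)%:Z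
    = (Q - 1 - b%:Z) * N + (entry_dist n.+1 b.+1 a.+1)%:Z.
  move=> ab; have [bq1 | bq1] := boolP (b.+1 < q)%N.
    by rewrite low_dist_left // /exit_dist (negbTE q_even); lia.
  have Eb : b.+1 = q by lia.
  by rewrite Eb /low_dist ltnn /column_dist /entry_dist (negbTE q_even); dist_lia.
rewrite (eq_bigr (fun a : 'I_n => (Q - j%:Z) + (Q - 1 - b%:Z) * N
    + (if odd b then a%:Z else N - 1 - a%:Z))); last first.
  move=> a _; rewrite /bump /= add1n -entry_distE; [|lia|exact: ltn_ord].
  by rewrite /comb_dist /= PoszD lowE //; lia.
rewrite big_split /= sum_const_int mulrDr [2 * (_ + \sum_(_ < _) _)]mulrDr.
rewrite sum_updown.
have -> : (comb_dist n.+1 q 1 j.+1 1 b.+1)%:Z = (if (j <= b)%N then b%:Z - j%:Z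
        else (Q - j%:Z) + (Q - 1 - b%:Z) * N + entry_top n b).
  rewrite /comb_dist /= ltnS; case: leqP => jb; first by lia.
  by rewrite PoszD lowE ?entry_dist_top; lia.
by ring.
Qed.

Lemma top_sum_diag j : (j < q)%N ->
  2 * top_sum j j = (2 * N * Q + 2 * N ^+ 2 * (Q - 1) + N * (N - 1))
    + (- 2 * N - 2 * N ^+ 2) * j%:Z.
Proof. by move=> jq; rewrite top_sumE // leqnn; ring. Qed.

(** The terms of [pair_sumE] that are free of [j] and [b]. *)
Definition pair_const : int :=
  2 * N * Q + 2 * N ^+ 2 * (Q - 1) + N * (N - 1) + 2 * Q + 2 * (Q - 1) * N
  + 2 * N * Q + 2 * N ^+ 2 * (Q - 1) + N * (N - 1) - N * (N + 1) * (N - 1)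
  + N ^+ 2 * (N - 1) + 2 * abs_sum n + 8.

Lemma pair_sumE j b : (b < j < q)%N ->
  2 * (top_sum j b + low_sum j b + (top_sum b j + low_sum b j))
  = pair_const + (2 * N ^+ 3 + 2 * N ^+ 2) * j%:Z - 2 * (N + 1) ^+ 3 * b%:Z
    + 2 * (N + 1) * entry_top n b - 4 * ((j == b.+1 :> nat) : nat)%:Z.
Proof.
case/andP=> bj jq.
have := top_sumE jq (ltn_trans bj jq); have := top_sumE (ltn_trans bj jq) jq.
have := low_sum_left bj; have := low_sum_right bj.
rewrite (ltnW bj) leqNgt bj /= /pair_const => -> El Et Et'.
by rewrite 2!mulrDr mulrDr El Et' mulrDr Et; ring.
Qed.

End CombWiener.

(** * The explicit polynomial and the comparison of the two combs *)

Section Comparison.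

Import Order.TTheory GRing.Theory Num.Theory.
Local Open Scope ring_scope.

Lemma wiener_comb h k : (1 < h)%N -> (1 < k)%N ->
  let H := h%:Z in let K := k%:Z in
  3 * (wiener (@comb h.*2 k.*2))%:Z =
    18 - 36 * K + 24 * K ^+ 2 - 8 * H - 2 * H * K + 8 * H * K ^+ 2
    - 8 * H * K ^+ 3 - 6 * H ^+ 2 - 2 * H ^+ 2 * K - 12 * H ^+ 2 * K ^+ 2
    + 32 * H ^+ 2 * K ^+ 3 + 8 * H ^+ 3 + 8 * H ^+ 3 * K
    + 16 * H ^+ 3 * K ^+ 2 + 32 * H ^+ 3 * K ^+ 3.
Proof.
case: h => // h h_gt0 k_gt1 H K; rewrite doubleS.
have HE : h.+1%:Z = H by [].
have KE : k%:Z = K by [].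
clearbody H K.
(* After the shift of [h], an odd number of rows lies below the top one, as [turn_sumE] requires. *)
have [n nE] : exists n, n = h.*2.+1 by exists h.*2.+1.
have [q qE] : exists q, q = k.*2 by exists k.*2.
rewrite -nE -qE.
have n_gt2 : (2 < n)%N by lia.
have q_gt3 : (3 < q)%N by lia.
have q_gt0 : (0 < q)%N by lia.
have q1_lt : (q.-1 < q)%N by lia.
have q_even : ~~ odd q by rewrite qE odd_double.
have NE : n%:Z = 2 * H - 1 by lia.
have QE : q%:Z = 2 * K by lia.
rewrite wiener_split //.
rewrite (sum_square_split (fun j b => top_sum n q j b + low_sum n q j b)).
rewrite [X in X + _]big_split /=.
have parity (c d : int) :
    \sum_(j < q) (if odd j then c else d) = k%:Z * (c + d).
  by rewrite qE sum_parity.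
set N := n%:Z; set Q := q%:Z.
have pairs : 2 * \sum_(j < q) \sum_(b < j) (top_sum n q j b + low_sum n q j b
      + (top_sum n q b j + low_sum n q b j))
    = \sum_(j < q) \sum_(b < j) (pair_const n q
        + (2 * N ^+ 3 + 2 * N ^+ 2) * j%:Z + (- 2 * (N + 1) ^+ 3) * b%:Z)
      + 2 * (N + 1) * (\sum_(j < q) \sum_(b < j) entry_top n b)
      - 4 * \sum_(j < q) \sum_(b < j) ((j == b.+1 :> nat) : nat)%:Z.
  rewrite mulr_sumr 2!mulr_sumr -big_split -sumrB; apply: eq_bigr => j _ /=.
  rewrite mulr_sumr 2!mulr_sumr -big_split -sumrB; apply: eq_bigr => b _ /=.
  by rewrite pair_sumE ?ltn_ord // /N; ring.
have tops : 2 * \sum_(j < q) top_sum n q j j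
    = \sum_(j < q) ((2 * N * Q + 2 * N ^+ 2 * (Q - 1) + N * (N - 1))
        + (- 2 * N - 2 * N ^+ 2) * j%:Z).
  by rewrite mulr_sumr; apply: eq_bigr => j _; rewrite top_sum_diag.
have lows : 2 * \sum_(j < q) low_sum n q j j
    = k%:Z * (2 * N ^+ 2 + 6 * N - 4 + 4 * (diff_sum n + turn_sum n))
      + (2 * N ^+ 2 - 2 * N + 4 + 4 * (far_sum n - turn_sum n)).
  rewrite mulr_sumr (eq_bigr _ (fun (j : 'I_q) _ =>
    low_sum_diag n_gt2 q_gt3 q_even (ltn_ord j))).
  rewrite !big_split /= -!mulr_sumr !sum_delta q_gt0 q1_lt parity /= /N.
  by ring.
have succs :
    \sum_(j < q) \sum_(b < j) ((j == b.+1 :> nat) : nat)%:Z = Q - 1.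
  by rewrite /Q -(@prednK q) ?sum_triangle_succ; lia.
have entries := sum_triangle_parity k 1 N; rewrite -qE in entries.
have turns := turn_sumE h; rewrite -nE in turns.
have tri := sum_triangle_affine q (pair_const n q)
  (2 * N ^+ 3 + 2 * N ^+ 2) (- 2 * (N + 1) ^+ 3).
have aff := sum_affine q (2 * N * Q + 2 * N ^+ 2 * (Q - 1) + N * (N - 1))
  (- 2 * N - 2 * N ^+ 2).
have absE := abs_sumE n; have diffE := diff_sumE n; have farE := far_sumE n.
move: pairs tops lows tri aff turns.
rewrite /entry_top entries succs /pair_const.
have -> : h%:Z = H - 1 by lia.
move: NE QE absE diffE farE; rewrite KE /N /Q {N Q entries succs}.
move: n%:Z q%:Z (abs_sum n) (diff_sum n) (far_sum n) (turn_sum n).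
move=> N Q S X Y Z -> -> ES EX EY.
move: (\sum_(j < q) top_sum _ _ _ _) (\sum_(j < q) low_sum _ _ _ _) => T L.
move: (\sum_(i < q) _) (\sum_(i < q) _) (\sum_(i < q) _) => A B P.
move=> EP ET EL EB EA EZ.
(* The factor 12 brings every sum to a multiple of the one that its closed form evaluates. *)
apply: (@mulfI _ 12) => //.
transitivity (9 * (2 * (2 * T)) + 18 * (2 * L) + 18 * (2 * P)); first by ring.
rewrite EP ET EL EA.
(* [pair_const] contains [2 * S]; its share is removed here and restored below as a multiple of
   [6 * S]. *)
pose pairs := 3 * (6 * B) - 36 * K * (2 * K - 1) * S.
transitivity (9 * (2 * A) + pairs + 6 * K * (2 * K - 1) * (6 * S)
  + 12 * K * (6 * X) + 24 * (K - 1) * (3 * Z) + 36 * (2 * Y)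
  + 36 * (K * (4 * H ^+ 2 + 2 * H - 4) + 4 * H ^+ 2 - 6 * H + 4
    + 2 * H * ((2 * H - 1) * K ^+ 2 + K * (K - 1)) - 2 * (2 * K - 1))).
  by rewrite /pairs EA; ring.
by rewrite /pairs EA EB ES EX EY EZ; ring.
Qed.

Lemma wiener_comb_lt h k : (1 < h)%N -> (h < k)%N ->
  (wiener (@comb k.*2 h.*2) < wiener (@comb h.*2 k.*2))%N.
Proof.
move=> h_gt1 hk; have k_gt1 : (1 < k)%N by lia.
have := wiener_comb h_gt1 k_gt1; have := wiener_comb k_gt1 h_gt1 => /=.
move: (wiener _) (wiener _) => w w' E E'.
have [e hE] : exists e, h = e.+2 by exists h.-2; lia.
have [d kE] : exists d, k = (e.+3 + d)%N by exists (k - e.+3)%N; lia.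
have gapE : 3 * (w%:Z - w'%:Z)
    = (d%:Z + 1) * (126 + 114 * d%:Z + 24 * d%:Z ^+ 2
      + (358 + 274 * d%:Z + 48 * d%:Z ^+ 2) * e%:Z
      + (338 + 176 * d%:Z + 16 * d%:Z ^+ 2) * e%:Z ^+ 2
      + (128 + 32 * d%:Z) * e%:Z ^+ 3 + 16 * e%:Z ^+ 4).
  rewrite mulrBr E E' kE hE (_ : (e.+3 + d)%N%:Z = e%:Z + 3 + d%:Z); last by lia.
  by rewrite (_ : e.+2%:Z = e%:Z + 2); [ring | lia].
have : 0 < 3 * (w%:Z - w'%:Z) by rewrite gapE mulr_gt0 //; lia.
lia.
Qed.

End Comparison.

Theorem theorem4 (m n : nat) (hm : ~~ odd m) (hn : ~~ odd n)
  (h4m : 4 <= m) (hmn : m < n) :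
  wiener (@comb m n) > wiener (@comb n m).
Proof.
have -> : m = m./2.*2 by lia.
have -> : n = n./2.*2 by lia.
by apply: wiener_comb_lt; lia.
Qed.
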